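(* $\overline{\mathbb{E}}$ is polynomially convex; that is, for every $x\in\mathbb{C}^3\setminus\overline{\mathbb{E}}$ there is a polynomial $f$ in three complex variables such that $|f|\le1$ on $\overline{\mathbb{E}}$ and $|f(x)|>1$.
   Context: The tetrablock is $\mathbb{E}=\{x\in\mathbb{C}^3: 1-x_1z-x_2w+x_3zw\ne0 \text{ whenever } |z|\le1,\ |w|\le1\}$, and $\overline{\mathbb{E}}$ is its closure in $\mathbb{C}^3$. *)

(* Defs.v *)
From mathcomp Require Import all_boot all_order all_algebra.
From mathcomp Require Import complex.
From mathcomp Require Import all_classical reals topology normedtype.
From mathcomp Require mpoly.

Set Implicit Arguments.
Unset Strict Implicit.
Unset Printing Implicit Defensive.

Import Order.TTheory GRing.Theory Num.Theory.
Import numFieldNormedType.Exports.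

Local Open Scope classical_set_scope.
Local Open Scope ring_scope.

(* [R[i]] is packaged as a [numClosedFieldType] so that the canonical topology
   of a numeric field (given by the modulus) is inferred on it; ['rV_n] then
   carries the product topology. *)
Definition Cplx (R : realType) : numClosedFieldType := R[i].

Definition mpoly_at (R : realType) (n : nat)
    (f : mpoly.mpoly n (Cplx R)) (x : 'rV[Cplx R]_n) : Cplx R :=
  mpoly.meval (fun i : 'I_n => x 0 i) f.

Definition polynomially_convex (R : realType) (n : nat)
    (K : set 'rV[Cplx R]_n) : Prop :=
  forall x : 'rV[Cplx R]_n, ~ K x ->
    exists f : mpoly.mpoly n (Cplx R),
      (forall y : 'rV[Cplx R]_n, K y -> `|mpoly_at f y| <= 1) /\
      1 < `|mpoly_at f x|.

(* The coordinates x_1, x_2, x_3 have indices 0, 1, 2 in ['I_3]. *)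
Definition tetrablock (R : realType) : set 'rV[Cplx R]_3 :=
  [set x : 'rV[Cplx R]_3 | forall z w : Cplx R, `|z| <= 1 -> `|w| <= 1 ->
    1 - x 0 0 * z - x 0 1 * w + x 0 2 * (z * w) != 0].

(* Main.v *)
(* If x is outside the closure of the tetrablock, then 1 - x1 z - x2 w + x3 zw = 0
   for some z, w in the open unit disc: otherwise (r x1, r x2, r^2 x3), which tends
   to x as r -> 1, would lie in the tetrablock for all r < 1.  Fix such z, w and put
   b(y) = y1 z + y2 w, c(y) = y3 zw and 1 - b T + c T^2 = (1 - s T)(1 - t T).
   On the tetrablock |s| and |t| are at most max(|z|, |w|) < 1, whereas at x we have
   {s, t} = {1, c(x)}.  Hence the polynomials c^n = (s t)^n and s^n + t^n are uniformly
   small on the tetrablock for large n, while at x they equal c(x)^n and 1 + c(x)^n,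
   which cannot both have modulus less than 1/2. *)
Require Import Defs.
From mathcomp Require Import all_boot all_order all_algebra.
From mathcomp Require Import complex.
From mathcomp Require Import all_classical reals topology normedtype sequences.
From mathcomp Require Import -(notations) mpoly.
From mathcomp Require Import ring.
Import Order.TTheory GRing.Theory Num.Theory.
Import numFieldNormedType.Exports.

Local Open Scope classical_set_scope.
Local Open Scope ring_scope.

(* The power sum s^n + t^n in terms of b = s + t and c = s t. *)
Fixpoint psum2 (A : comNzRingType) (b c : A) (n : nat) {struct n} : A :=
  match n with
  | 0 => 2
  | m.+1 => if m is k.+1 then b * psum2 A b c m - c * psum2 A b c k else b
  end.
Arguments psum2 {A}.

Lemma nat_ind2 (P : nat -> Prop) : P 0 -> P 1 ->
  (forall n, P n -> P n.+1 -> P n.+2) -> forall n, P n.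
Proof.
move=> P0 P1 PS n; suff [] : P n /\ P n.+1 by [].
by elim: n => // n [Pn PSn]; split=> //; exact: PS.
Qed.

Lemma psum2S (A : comNzRingType) (b c : A) n :
  psum2 b c n.+2 = b * psum2 b c n.+1 - c * psum2 b c n.
Proof. by []. Qed.

Lemma psum2E (A : comNzRingType) (s t : A) n :
  psum2 (s + t) (s * t) n = s ^+ n + t ^+ n.
Proof.
elim/nat_ind2: n => [||n IHn IHSn]; rewrite ?expr0 ?expr1 //.
by rewrite psum2S IHn IHSn !exprS; ring.
Qed.

Lemma rmorph_psum2 (A B : comNzRingType) (f : {rmorphism A -> B}) b c n :
  f (psum2 b c n) = psum2 (f b) (f c) n.
Proof.
elim/nat_ind2: n => [||n IHn IHSn]; rewrite ?rmorph_nat //.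
by rewrite psum2S rmorphB !rmorphM IHn IHSn.
Qed.

Lemma quadratic_factors (F : closedFieldType) (b c : F) :
  exists s t, b = s + t /\ c = s * t.
Proof.
(* The list holds the lower coefficients of the equation [s ^+ 2 = - c + b * s]; the other root is
   then [b - s]. *)
have [s hs] := solve_monicpoly (nth 0 [:: - c; b]) (isT : (0 < 2)%N).
exists s, (b - s); split; first by ring.
by move: hs; rewrite !big_ord_recl big_ord0 /= => hs; ring: hs.
Qed.

Section Tetrablock.
Variable R : realType.
Local Notation C := (Cplx R).

Lemma exists_expr_small (r e : C) : 0 <= r -> r < 1 -> 0 < e ->
  exists n, r ^+ n <= e.
Proof.
move=> r0 r1 e0.
(* The order on the complex field is partial, but elements comparable with 0 are real, so the claim
   reduces to geometric convergence in [R]. *)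
have rE : r = (complex.Re r)%:C%C by rewrite RRe_real // ger0_real.
have eE : e = (complex.Re e)%:C%C by rewrite RRe_real // gtr0_real.
move: r0 r1 e0; rewrite rE eE !ltcR lecR => r0 r1 e0.
have r1' : `|complex.Re r| < 1 by rewrite ger0_norm.
have /cvgr0_norm_lt /(_ _ e0) [n _ /(_ n (leqnn n)) /ltW] := cvg_expr r1'.
rewrite /= ger0_norm ?exprn_ge0 // => rn; exists n.
by rewrite -(rmorphXn (real_complex R)) lecR.
Qed.

(** Scaling the coordinates with weights 1, 1, 2 by [r < 1] amounts to replacing [(z, w)] by
    [(r * z, r * w)], which moves the closed bidisc into the open one. *)
Lemma closure_tetrablock_sup (x : 'rV[C]_3) :
  (forall z w : C, `|z| < 1 -> `|w| < 1 ->
    1 - x 0 0 * z - x 0 1 * w + x 0 2 * (z * w) != 0) ->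
  closure (@tetrablock R) x.
Proof.
move=> hx B /nbhs_ballP[e /= e0 eB].
pose M := 1 + \sum_i `|x 0 i|.
have M1 : 1 <= M by rewrite lerDl sumr_ge0.
have M0 : 0 < M by exact: lt_le_trans M1.
(* Each coordinate moves by at most [(1 - r ^+ 2) * M <= 2 * d * M]; this [d] keeps that below [e]
   and also makes [r = 1 - d] positive. *)
pose d : C := e / (2 * M + e).
have De : 0 < 2 * M + e by rewrite addr_gt0 // mulr_gt0.
have d0 : 0 < d by rewrite divr_gt0.
have d1 : d < 1 by rewrite ltr_pdivrMr // mul1r ltrDr mulr_gt0.
have dM : 2 * d * M < e.
  have -> : 2 * d * M = e * (2 * M / (2 * M + e)) by rewrite /d; ring.
  by rewrite gtr_pMr // ltr_pdivrMr // mul1r ltrDl.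
pose r := 1 - d.
have r0 : 0 < r by rewrite subr_gt0.
have r1 : r < 1 by rewrite ltrBlDr ltrDl.
have rlt1 u : `|u| <= 1 -> `|r * u| < 1.
  by move=> u1; rewrite normrM gtr0_norm // (le_lt_trans _ r1) // ger_pMr.
pose k (i : 'I_3) : nat := if i == 2 then 2%N else 1%N.
exists (\row_i (r ^+ k i * x 0 i)); split.
  move=> z w z1 w1; rewrite !mxE /=.
  have := hx (r * z) (r * w) (rlt1 z z1) (rlt1 w w1).
  by congr (_ != 0); rewrite /k /=; ring.
apply: eB; split=> // i j; rewrite ord1 -ball_normE /= mxE.
have xM : `|x 0 j| <= M.
  by rewrite /M (bigD1 j) //= addrCA lerDl addr_ge0 // sumr_ge0.
apply: le_lt_trans dM; rewrite -{1}[x 0 j]mul1r -mulrBl normrM.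
apply: ler_pM => //.
rewrite /k; case: ifP => _.
  have -> : 1 - r ^+ 2 = d * (1 + r) by rewrite /r; ring.
  rewrite normrM mulrC (gtr0_norm d0) ler_pM2r // (gtr0_norm (addr_gt0 ltr01 r0)).
  by rewrite -[2]/(1 + 1) lerD2l ltW.
have -> : 1 - r ^+ 1 = d by rewrite /r; ring.
by rewrite (gtr0_norm d0) ler_peMl ?ler1n // ltW.
Qed.

(** If [r < |s|], then [(z / s, w / s)] lies in the closed bidisc, and there the defining expression
    equals [(1 - s T) (1 - t T)] at [T = 1 / s], which is 0. *)
Lemma tetrablock_root_bound (y : 'rV[C]_3) (z w s t r : C) :
  tetrablock y -> `|z| <= r -> `|w| <= r ->
  y 0 0 * z + y 0 1 * w = s + t -> y 0 2 * (z * w) = s * t -> `|s| <= r.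
Proof.
move=> Ey zr wr hb hc.
have r0 : 0 <= r by exact: le_trans zr.
rewrite real_leNgt ?ger0_real //; apply/negP => rs.
have s0 : s != 0 by rewrite -normr_gt0; exact: le_lt_trans rs.
have ns : 0 < `|s| by rewrite normr_gt0.
have small u : `|u| <= r -> `|u / s| <= 1.
  by move=> ur; rewrite normf_div ler_pdivrMr // mul1r (le_trans ur) // ltW.
have /negP[] := Ey _ _ (small z zr) (small w wr); apply/eqP.
have -> : 1 - y 0 0 * (z / s) - y 0 1 * (w / s) + y 0 2 * (z / s * (w / s)) =
  1 - (y 0 0 * z + y 0 1 * w) / s + y 0 2 * (z * w) / s ^+ 2 by field.
by rewrite hb hc; field.
Qed.

Lemma continuous_mpoly_at n (p : mpoly n C) : continuous (mpoly_at p).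
Proof.
have PD (p1 p2 : mpoly n C) : continuous (mpoly_at p1) ->
    continuous (mpoly_at p2) -> continuous (mpoly_at (p1 + p2)).
  move=> c1 c2; have -> : mpoly_at (p1 + p2) = fun y => mpoly_at p1 y + mpoly_at p2 y.
    by apply/funext => u; exact: mevalD.
  by move=> y; exact: continuousD (c1 y) (c2 y).
have PM (p1 p2 : mpoly n C) : continuous (mpoly_at p1) ->
    continuous (mpoly_at p2) -> continuous (mpoly_at (p1 * p2)).
  move=> c1 c2; have -> : mpoly_at (p1 * p2) = fun y => mpoly_at p1 y * mpoly_at p2 y.
    by apply/funext => u; exact: mevalM.
  by move=> y; exact: continuousM (c1 y) (c2 y).
have PC (a : C) : continuous (mpoly_at (mpolyC n a)).
  have -> : mpoly_at (mpolyC n a) = cst a by apply/funext => u; exact: mevalC.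
  exact: cst_continuous.
have PX i : continuous (mpoly_at (mpolyX C (mnm1 i : multinom n))).
  have -> : mpoly_at (mpolyX C (mnm1 i)) = fun y : 'rV[C]_n => y 0 i.
    by apply/funext => u; exact: mevalXU.
  exact: coord_continuous.
rewrite (mpolyE p).
apply: (big_ind (fun q => continuous (mpoly_at q))) => [||m _].
- exact: (PC 0).
- exact: PD.
rewrite -mul_mpolyC mpolyXE_id; apply: (PM) => //.
apply: (big_ind (fun q => continuous (mpoly_at q))) => [||i _].
- exact: (PC 1).
- exact: PM.
elim: (m i) => [|k IHk]; first by rewrite expr0; exact: (PC 1).
by rewrite exprS; exact: PM (PX i) IHk.
Qed.

Lemma le_norm_closure (T : topologicalType) (A : set T) (f : T -> C) (e : C) :
  continuous f -> e \is Num.real -> (forall y, A y -> `|f y| <= e) ->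
  forall y, closure A y -> `|f y| <= e.
Proof.
move=> fc er fA y Ay; rewrite real_leNgt //; apply/negP; rewrite -subr_gt0 => ey.
(* Some [u] in [A] has [f u] closer to [f y] than the gap [|f y| - e], which would force
   [|f u| > e]. *)
have /cvgr_dist_lt /(_ _ ey) /Ay [u [/fA fu /=]] := fc y.
rewrite real_ltNge ?realB //; apply/negP; rewrite negbK.
by apply: le_trans (lerB_dist _ _); rewrite lerD2l lerN2.
Qed.

(** Multiplying [q] by 4 turns the bound 1/4 into 1, which continuity carries to the closure, while
    the value at [x] gets modulus at least 2. *)
Lemma polynomial_separation (K : set 'rV[C]_3) (x : 'rV[C]_3)
    (q : mpoly 3 C) :
  (forall y, K y -> `|mpoly_at q y| <= 4^-1) ->
  1 <= `|2 * mpoly_at q x| ->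
  exists f : mpoly 3 C,
    (forall y, closure K y -> `|mpoly_at f y| <= 1) /\ 1 < `|mpoly_at f x|.
Proof.
move=> qK qx; exists (mpolyC 3 4 * q).
have fE y : mpoly_at (mpolyC 3 4 * q) y = 4 * mpoly_at q y.
  by rewrite /mpoly_at rmorphM /= mevalC.
split=> [y Ky|].
  have q4 : `|mpoly_at q y| <= 4^-1.
    by apply: le_norm_closure Ky => //; [exact: continuous_mpoly_at|rewrite realV realn].
  by rewrite fE normrM normr_nat -ler_pdivlMl ?ltr0n // mulr1.
rewrite fE (_ : 4 * _ = 2 * (2 * mpoly_at q x)); last by ring.
rewrite normrM normr_nat; apply: lt_le_trans (_ : 1 < 2) _; first by rewrite ltr1n.
by rewrite ler_peMr // ler0n.
Qed.

End Tetrablock.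

Theorem theorem2p9 (R : realType) : polynomially_convex (closure (@tetrablock R)).
Proof.
move=> x xE.
have [z [w [z1 w1 hzw]]] : exists z w : Cplx R, [/\ `|z| < 1, `|w| < 1 &
    1 - x 0 0 * z - x 0 1 * w + x 0 2 * (z * w) = 0].
  apply: contrapT => hn; apply: xE; apply: closure_tetrablock_sup => z w z1 w1.
  by apply/eqP => h0; apply: hn; exists z, w.
pose C := Cplx R.
have [r [r1 zr wr]] : exists r : C, [/\ r < 1, `|z| <= r & `|w| <= r].
  have [zw|wz] := real_leP (normr_real z) (normr_real w).
    by exists `|w|.
  by exists `|z|; rewrite lexx (ltW wz).
have r0 : 0 <= r by exact: le_trans zr.
(* With 1/8 for each of [s ^+ n] and [t ^+ n], their sum is at most 1/4 in modulus, and so is their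
   product. *)
have [|n hn] := exists_expr_small R r 8^-1 r0 r1; first by rewrite invr_gt0 ltr0n.
pose b (y : 'rV[C]_3) : C := y 0 0 * z + y 0 1 * w.
pose c (y : 'rV[C]_3) : C := y 0 2 * (z * w).
pose X (i : 'I_3) : mpoly 3 C := mpolyX C (mnm1 i).
pose K (a : C) : mpoly 3 C := mpolyC 3 a.
pose pb := X 0 * K z + X 1 * K w.
pose pc := X 2 * K (z * w).
have bE y : mpoly_at pb y = b y.
  by rewrite /mpoly_at /pb rmorphD !rmorphM /= !mevalXU !mevalC.
have cE y : mpoly_at pc y = c y.
  by rewrite /mpoly_at /pc rmorphM /= !mevalXU !mevalC.
have pcE y : mpoly_at (pc ^+ n) y = c y ^+ n by rewrite -cE /mpoly_at rmorphXn.
have psumE y : mpoly_at (psum2 pb pc n) y = psum2 (b y) (c y) n.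
  by rewrite -bE -cE /mpoly_at rmorph_psum2.
have key y : tetrablock y ->
    `|c y ^+ n| <= 4^-1 /\ `|psum2 (b y) (c y) n| <= 4^-1.
  move=> Ey; have [s [t [hb hc]]] := quadratic_factors _ (b y) (c y).
  have sr := tetrablock_root_bound R y z w s t r Ey zr wr hb hc.
  have tr : `|t| <= r.
    apply: (tetrablock_root_bound R y z w t s r Ey zr wr).
      by rewrite [t + s]addrC.
    by rewrite [t * s]mulrC.
  have e8 u : `|u| <= r -> `|u ^+ n| <= 8^-1.
    by move=> ur; rewrite normrX (le_trans _ hn) // lerXn2r ?nnegrE.
  have [s8 t8] := (e8 s sr, e8 t tr).
  have e84 : 8^-1 + 8^-1 = 4^-1 :> C by field.
  rewrite hb hc psum2E exprMn normrM; split.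
    rewrite -e84 (le_trans (_ : _ <= `|s ^+ n| * 1)) //.
      rewrite ler_wpM2l // (le_trans t8) // invf_le1 ?ler1n //.
    by rewrite mulr1 (le_trans s8) // lerDl invr_ge0.
  by rewrite -e84 (le_trans (ler_normD _ _)) // lerD.
have psumx : psum2 (b x) (c x) n = 1 + c x ^+ n.
  (* The choice of [z] and [w] says that [T = 1] is a root of [1 - b T + c T^2] at [x]. *)
  have hb : b x = 1 + c x by apply/eqP; rewrite -subr_eq0 -oppr_eq0 -hzw /b /c; apply/eqP; ring.
  by rewrite hb -{2}[c x]mul1r psum2E expr1n.
have [hx|hx] : 1 <= `|2 * mpoly_at (pc ^+ n) x| \/
    1 <= `|2 * mpoly_at (psum2 pb pc n) x|.
  rewrite pcE psumE psumx.
  have [|lt1] := real_leP (real1 C) (normr_real (2 * c x ^+ n)); [by left|right].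
  (* By the reverse triangle inequality, [|2 * c x ^+ n| < 1] leaves modulus at least 2 - 1 for the
     other value. *)
  have -> : 2 * (1 + c x ^+ n) = 2 - - (2 * c x ^+ n) by ring.
  apply: le_trans (lerB_dist _ _); rewrite normrN normr_nat lerBrDr.
  by rewrite -[2]/(1 + 1) lerD2l ltW.
- by apply: polynomial_separation hx => y /key[]; rewrite pcE.
- by apply: polynomial_separation hx => y /key[]; rewrite psumE.
Qed.
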